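(* Let $\mathscr{H}$ be a complex Hilbert space, let $k,n$ be positive integers, and let $T,S$ be non-zero bounded linear operators on $\mathscr{H}$. If $T$ and $S$ are $k$-quasi $n$-power posinormal operators, then the tensor product $T\otimes S$ on $\mathscr{H}\otimes\mathscr{H}$ is a $k$-quasi $n$-power posinormal operator.
   Context: For a bounded operator $X$, $R(X)$ denotes its range and $X^{*k}=(X^* )^k$. A bounded operator $T$ on a Hilbert space is $k$-quasi $n$-power posinormal if $R(T^{*k}T^n)\subseteq R(T^{*(k+1)})$; equivalently, there is $\lambda>0$ with $T^{*k}(\lambda^2T^*T-T^nT^{*n})T^k\ge 0$. $\mathscr{H}\otimes\mathscr{H}$ is the Hilbert space tensor product, and $T\otimes S$ is the bounded operator determined by $(T\otimes S)(x\otimes y)=Tx\otimes Sy$. *)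

(* Defs.v *)
From HB Require Import structures.
From mathcomp Require Import all_boot all_order all_algebra all_classical all_reals interval_inference.
From mathcomp Require Import topology normedtype sequences complex ring lra.
Set Implicit Arguments. Unset Strict Implicit. Unset Printing Implicit Defensive.
Import Order.TTheory GRing.Theory Num.Theory.
Import numFieldNormedType.Exports.
Local Open Scope classical_set_scope.
Local Open Scope ring_scope.
Local Notation "r %:C" := (real_complex _ r) (format "r %:C") : ring_scope.
Local Notation Re := complex.Re.

(* Complex Hilbert spaces over C = R[i], where R is a model of the real numbers.
   hdot is linear in its first argument and conjugate-linear in the second;
   norms take their (real, nonnegative) values in R[i]. *)
HB.mixin Record CompleteNormedModule_isHilbert (R : realType) H
    & CompleteNormedModule R[i] H := {
  hdot : {dot H for Num.conj};
  hdot_sqrnorm : forall x : H, hdot x x = `|x| ^+ 2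
}.
#[short(type="hilbertType")]
HB.structure Definition Hilbert (R : realType) :=
  { H of CompleteNormedModule_isHilbert R H & CompleteNormedModule R[i] H }.

Section Hilbert_theory.
Variables (R : realType) (H : hilbertType R).
Implicit Types (x y z : H) (a b : R[i]).

Lemma hdotC x y : hdot x y = (hdot y x)^*.
Proof. by rewrite (hermC hdot) expr0 mul1r. Qed.

Lemma hdotDl x y z : hdot (x + y) z = hdot x z + hdot y z.
Proof. exact: linearDl. Qed.
Lemma hdotDr x y z : hdot x (y + z) = hdot x y + hdot x z.
Proof. exact: linearDr. Qed.
Lemma hdotNl x y : hdot (- x) y = - hdot x y.
Proof. exact: linearNl. Qed.
Lemma hdotNr x y : hdot x (- y) = - hdot x y.
Proof. exact: linearNr. Qed.
Lemma hdotZl a x y : hdot (a *: x) y = a * hdot x y.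
Proof. exact: linearZl_LR. Qed.
Lemma hdotZr a x y : hdot x (a *: y) = a^* * hdot x y.
Proof. exact: linearZr_LR. Qed.
Lemma hdot0l y : hdot 0 y = 0.
Proof. exact: linear0l. Qed.
Lemma hdot0r y : hdot y 0 = 0.
Proof. exact: linear0r. Qed.

Lemma hdot_suml (I : Type) (r : seq I) (F : I -> H) y :
  hdot (\sum_(i <- r) F i) y = \sum_(i <- r) hdot (F i) y.
Proof.
by apply: (big_morph (hdot^~ y)) => [u v|]; rewrite ?hdotDl ?hdot0l.
Qed.
Lemma hdot_sumr (I : Type) (r : seq I) (F : I -> H) y :
  hdot y (\sum_(i <- r) F i) = \sum_(i <- r) hdot y (F i).
Proof.
by apply: (big_morph (hdot y)) => [u v|]; rewrite ?hdotDr ?hdot0r.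
Qed.

Lemma hdot_inj x y : (forall z, hdot z x = hdot z y) -> x = y.
Proof.
move=> xy; apply/eqP; rewrite -subr_eq0 -(dnorm_eq0 hdot).
by rewrite hdotDr hdotNr xy subrr.
Qed.

Definition nrm x : R := Re `|x|.
Definition ip x y : R := Re (hdot x y).

Lemma RcM (r s : R) : (r * s)%:C = r%:C * s%:C.
Proof. exact: rmorphM. Qed.

Lemma nrmE x : `|x| = (nrm x)%:C.
Proof. by rewrite /nrm RRe_real// normr_real. Qed.

Lemma nrm_ge0 x : 0 <= nrm x.
Proof. by rewrite -ler0c -nrmE. Qed.

Lemma ipxx x : ip x x = nrm x ^+ 2.
Proof. by rewrite /ip hdot_sqrnorm nrmE -rmorphXn. Qed.

Lemma hdotxx x : hdot x x = (nrm x ^+ 2)%:C.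
Proof. by rewrite hdot_sqrnorm nrmE -rmorphXn. Qed.

Lemma ReD a b : Re (a + b) = Re a + Re b. Proof. by case: a b => [? ?] []. Qed.
Lemma ReN a : Re (- a) = - Re a. Proof. by case: a. Qed.
Lemma ReZ (r : R) a : Re (r%:C * a) = r * Re a.
Proof. by case: a => ? ? /=; rewrite mul0r subr0. Qed.
Lemma ReJ a : Re a^* = Re a. Proof. by case: a. Qed.

Lemma ipC x y : ip x y = ip y x.
Proof. by rewrite /ip hdotC ReJ. Qed.
Lemma ipDl x y z : ip (x + y) z = ip x z + ip y z.
Proof. by rewrite /ip hdotDl ReD. Qed.
Lemma ipDr x y z : ip x (y + z) = ip x y + ip x z.
Proof. by rewrite /ip hdotDr ReD. Qed.
Lemma ipNl x y : ip (- x) y = - ip x y.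
Proof. by rewrite /ip hdotNl ReN. Qed.
Lemma ipNr x y : ip x (- y) = - ip x y.
Proof. by rewrite /ip hdotNr ReN. Qed.
Lemma ipZl (r : R) x y : ip (r%:C *: x) y = r * ip x y.
Proof. by rewrite /ip hdotZl ReZ. Qed.
Lemma ipZr (r : R) x y : ip x (r%:C *: y) = r * ip x y.
Proof. by rewrite ipC ipZl ipC. Qed.

Lemma ip_CS x y : `|ip x y| <= nrm x * nrm y.
Proof.
have [->|y0] := eqVneq y 0.
  by rewrite /ip hdot0r normr0 mulr_ge0 ?nrm_ge0.
have ny0 : 0 < nrm y by rewrite -ltcR -nrmE normr_gt0.
rewrite -(@ler_pXn2r _ 2)// ?nnegrE ?mulr_ge0 ?nrm_ge0//.
rewrite real_normK ?num_real//.
set t := ip x y.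
have : 0 <= ip ((nrm y ^+ 2)%:C *: x - t%:C *: y) ((nrm y ^+ 2)%:C *: x - t%:C *: y).
  by rewrite ipxx sqr_ge0.
rewrite ipDl !ipDr !ipNl !ipNr !ipZl !ipZr !ipxx (ipC y x) -/t => h.
have {}h : 0 <= nrm y ^+ 2 * ((nrm x * nrm y) ^+ 2 - t ^+ 2).
  by apply: le_trans h _; rewrite le_eqVlt; apply/orP; left; apply/eqP; ring.
by rewrite pmulr_rge0 ?exprn_gt0// subr_ge0 in h.
Qed.

Lemma hdot_CS x y : `|hdot x y| <= `|x| * `|y|.
Proof.
have [->|h0] := eqVneq (hdot x y) 0; first by rewrite normr0 mulr_ge0.
pose u := (hdot x y)^* / `|hdot x y|.
have u1 : `|u| = 1 by rewrite normf_div norm_conjC normr_id divff// normr_eq0.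
have e : hdot (u *: x) y = `|hdot x y|.
  by rewrite hdotZl mulrAC mulrC -(mulrC (hdot x y)) -normCK expr2 mulKf ?normr_eq0.
have := ip_CS (u *: x) y.
rewrite /ip e -lecR RcM -!nrmE normrZ u1 mul1r.
apply: le_trans.
set w := `|hdot x y|; have : w \is Num.real by exact: normr_real.
by move=> /RRe_real {1}<-; rewrite lecR ler_norm.
Qed.

End Hilbert_theory.

Section Riesz.
Variables (R : realType) (H : hilbertType R).
(* V is a set of parameters of a subspace of H, not required to be a vector
   space itself *)
Variables (V : Type) (add : V -> V -> V) (scale : R[i] -> V -> V).
Variables (iota : V -> H) (f : V -> R[i]) (M : R).
Hypothesis iotaD : forall u v, iota (add u v) = iota u + iota v.
Hypothesis iotaZ : forall a v, iota (scale a v) = a *: iota v.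
Hypothesis fD : forall u v, f (add u v) = f u + f v.
Hypothesis fZ : forall a v, f (scale a v) = a * f v.
Hypothesis f_bounded : forall v, `|f v| <= M%:C * `|iota v|.
Variable v0 : V.

Let g v : R := Re (f v).
Let J v : R := nrm (iota v) ^+ 2 - 2 * g v.

Let g_bounded v : `|g v| <= M * nrm (iota v).
Proof.
rewrite -lecR RcM -nrmE; apply: le_trans (f_bounded v).
by rewrite normc_ge_Re.
Qed.

Let J_ge v : - M ^+ 2 <= J v.
Proof.
rewrite /J; have := le_trans (ler_norm _) (g_bounded v).
have := sqr_ge0 (nrm (iota v) - M).
set n := nrm _; nra.
Qed.

Let has_inf_J : has_inf (range J).
Proof.
split; first by exists (J v0), v0.
by exists (- M ^+ 2) => _ [v _ <-]; exact: J_ge.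
Qed.

Let m := inf (range J).

Let m_le v : m <= J v.
Proof. by apply: ge_inf; [case: has_inf_J | exists v]. Qed.

Let minimizing n : exists v, J v < m + n.+1%:R^-1.
Proof.
have e0 : 0 < n.+1%:R^-1 :> R by rewrite invr_gt0 ltr0Sn.
by have [_ [v _ <-] h] := inf_adherent e0 has_inf_J; exists v.
Qed.

Let gZ (r : R) v : g (scale r%:C v) = r * g v.
Proof. by rewrite /g fZ ReZ. Qed.
Let gD u v : g (add u v) = g u + g v.
Proof. by rewrite /g fD ReD. Qed.

Let J_mid u v : nrm (iota u - iota v) ^+ 2 <= 2 * (J u + J v - 2 * m).
Proof.
have := m_le (scale (2^-1)%:C (add u v)).
rewrite /J gZ gD -!ipxx iotaZ iotaD !(ipDl, ipDr, ipZl, ipZr, ipNl, ipNr).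
rewrite (ipC (iota v) (iota u)). lra.
Qed.

Let J_var v w (r : R) : nrm (iota w) <= r -> 0 < r ->
  (ip (iota w) (iota v) - g w) ^+ 2 <= r ^+ 2 * (J v - m).
Proof.
move=> wr r0; set c := ip (iota w) (iota v) - g w.
have := m_le (add v (scale (- c / r ^+ 2)%:C w)).
rewrite /J gD gZ -!ipxx iotaD iotaZ !(ipDl, ipDr, ipZl, ipZr).
rewrite (ipC (iota v) (iota w)) (ipxx (iota w)).
have nw : nrm (iota w) ^+ 2 <= r ^+ 2 by rewrite ler_pXn2r ?nnegrE ?nrm_ge0// ltW.
set s := c / r ^+ 2.
have -> : - c / r ^+ 2 = - s by rewrite mulNr.
have cs : c = s * r ^+ 2 by rewrite /s mulfVK// expf_neq0// gt_eqF.
move=> h.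
have {}h : 2 * s * c <= (J v - m) + s ^+ 2 * nrm (iota w) ^+ 2.
  rewrite /J -ipxx /c; lra.
have h2 : s ^+ 2 * nrm (iota w) ^+ 2 <= s ^+ 2 * r ^+ 2 by rewrite ler_wpM2l ?sqr_ge0.
have sc : s ^+ 2 * r ^+ 2 = s * c by rewrite [in RHS]cs; ring.
have -> : c ^+ 2 = r ^+ 2 * (s * c) by rewrite -sc [in LHS]cs; ring.
rewrite ler_wpM2l ?sqr_ge0//; rewrite sc in h2; move: h h2.
set n2 := s ^+ 2 * _; set sc' := s * c => h h2.
have : 2 * sc' <= J v - m + n2 by rewrite /sc' mulrA.
by rewrite /J -ipxx; lra.
Qed.

Lemma riesz : exists w, forall v, f v = hdot (iota v) w.
Proof.
have [v vP] := choice minimizing.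
pose u n := iota (v n).
have dist n k : nrm (u n - u k) ^+ 2 <= 2 * (n.+1%:R^-1 + k.+1%:R^-1).
  apply: le_trans (J_mid _ _) _.
  move: (vP n) (vP k); move: (J _) (J _) n.+1%:R^-1 k.+1%:R^-1 => a b c d; lra.
have cu : cauchy (u @ \oo).
  apply: cauchy_exP => e e0.
  have eR : e = (Re e)%:C by rewrite RRe_real// gtr0_real.
  have e'0 : 0 < Re e by rewrite -ltcR -eR.
  have [n _ nP] : \forall n \near \oo, n.+1%:R^-1 < Re e ^+ 2 / 4 :> R.
    have e4 : 0 < Re e ^+ 2 / 4 by rewrite divr_gt0 ?exprn_gt0.
    exact: near_infty_natSinv_lt (PosNum e4).
  exists (u n), n => // k /= nk; rewrite -ball_normE/= nrmE eR ltcR.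
  rewrite -(@ltr_pXn2r _ 2) ?nnegrE ?nrm_ge0 ?ltW//.
  apply: le_lt_trans (dist _ _) _.
  move: (nP n (leqnn n)) (nP k nk) => /=.
  move: n.+1%:R^-1 k.+1%:R^-1 => a b; lra.
have /cvg_ex[w uw] : cvg (u @ \oo) by exact: cauchy_cvg.
have gw v1 : g v1 = ip (iota v1) w.
  apply/eqP; rewrite -subr_eq0 -normr_eq0 eq_le normr_ge0 andbT.
  apply/ler_addgt0Pr => e e0; rewrite add0r.
  pose r := nrm (iota v1) + 1.
  have r0 : 0 < r by rewrite ltr_wpDl ?nrm_ge0.
  have : \forall n \near \oo, n.+1%:R^-1 < (e / (2 * r)) ^+ 2 :> R.
    have e2 : 0 < (e / (2 * r)) ^+ 2 by rewrite exprn_gt0// divr_gt0 ?mulr_gt0.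
    exact: near_infty_natSinv_lt (PosNum e2).
  have : \forall n \near \oo, `|w - u n| < (e / (2 * r))%:C.
    by apply: cvgr_dist_lt => //; rewrite ltcR divr_gt0 ?mulr_gt0.
  move=> near_w near_n; near \oo => n.
  have h1 : nrm (w - u n) < e / (2 * r) by rewrite -ltcR -nrmE; near: n.
  have h2 : n.+1%:R^-1 < (e / (2 * r)) ^+ 2 :> R by near: n.
  have rv : nrm (iota v1) <= r by rewrite lerDl.
  have h4 : (ip (iota v1) (u n) - g v1) ^+ 2 <= (e / 2) ^+ 2.
    apply: le_trans (J_var (v n) rv r0) _.
    have -> : e / 2 = r * (e / (2 * r)) by field; rewrite gt_eqF.
    rewrite [leRHS]exprMn ler_wpM2l ?sqr_ge0//; apply: ltW; apply: lt_trans h2.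
    by rewrite ltrBlDl.
  have h5 : `|ip (iota v1) (u n) - g v1| <= e / 2.
    have e20 : 0 <= e / 2 by rewrite divr_ge0 ?ltW.
    by rewrite -(@ler_pXn2r _ 2) ?nnegrE// real_normK ?num_real.
  have h3 : `|ip (iota v1) (w - u n)| <= e / 2.
    apply: le_trans (ip_CS _ _) _.
    have -> : e / 2 = r * (e / (2 * r)) by field; rewrite gt_eqF.
    by apply: ler_pM; rewrite ?nrm_ge0// ltW.
  rewrite ipDr ipNr in h3.
  have -> : g v1 - ip (iota v1) w = - (ip (iota v1) (u n) - g v1) -
     (ip (iota v1) w - ip (iota v1) (u n)) by ring.
  by apply: le_trans (ler_normB _ _) _; rewrite normrN; lra.
exists w => v1.
have e1 := gw v1.
have := gw (scale 'i%C v1).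
rewrite /g fZ iotaZ /ip hdotZl !(mulrC 'i%C) !ReiNIm => /oppr_inj e2.
by apply/eqP; rewrite eq_complex -/(g v1) e1 e2 !eqxx.
Unshelve. all: by end_near. Qed.

End Riesz.

Section Schur.
Variables (R : realType) (U : lmodType R[i]) (H : hilbertType R).
Variable Q : U -> U -> R[i].
Hypothesis QDl : forall x y z, Q (x + y) z = Q x z + Q y z.
Hypothesis QDr : forall x y z, Q x (y + z) = Q x y + Q x z.
Hypothesis QZl : forall a x y, Q (a *: x) y = a * Q x y.
Hypothesis QZr : forall a x y, Q x (a *: y) = a^* * Q x y.
Hypothesis Q_ge0 : forall x, 0 <= Q x x.

Lemma psd_schur (s : seq (U * H)) :
  0 <= \sum_(p <- s) \sum_(q <- s) Q p.1 q.1 * hdot p.2 q.2.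
Proof.
have Q0l y : Q 0 y = 0 by rewrite -(scale0r 0) QZl mul0r.
have Q0r y : Q y 0 = 0 by rewrite -(scale0r 0) QZr conjC0 mul0r.
have QSl (t : seq (U * H)) F y : Q (\sum_(p <- t) F p) y = \sum_(p <- t) Q (F p) y.
  by apply: (big_morph (Q^~ y)).
have QSr (t : seq (U * H)) F y : Q y (\sum_(p <- t) F p) = \sum_(p <- t) Q y (F p).
  by apply: (big_morph (Q y)).
move: {2}(size s) (leqnn (size s)) => n; elim: n s => [|n IH] [|[x y] s] //=;
  rewrite ?big_nil// ltnS => ns.
pose a (p : U * H) := hdot p.2 y / hdot y y.
pose c (p : U * H) := (p.1, p.2 - a p *: y).
have ay p : hdot p.2 y = a p * hdot y y.
  have [->|y0] := eqVneq y 0; first by rewrite !hdot0r mulr0.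
  by rewrite /a divfK// dnorm_eq0.
have ay' p : hdot y p.2 = (a p)^* * hdot y y.
  by rewrite hdotC ay rmorphM/= -hdotC.
have ayy p q : hdot p.2 q.2 = a p * (a q)^* * hdot y y + hdot (c p).2 (c q).2.
  rewrite /c/= hdotDl !hdotDr !hdotNl !hdotNr !hdotZl !hdotZr ay ay'.
  ring.
pose X := x + \sum_(p <- s) a p *: p.1.
have -> : \sum_(p <- (x, y) :: s) \sum_(q <- (x, y) :: s) Q p.1 q.1 * hdot p.2 q.2 =
    Q X X * hdot y y +
    \sum_(p <- map c s) \sum_(q <- map c s) Q p.1 q.1 * hdot p.2 q.2.
  rewrite big_map; under [X in _ = _ + X]eq_bigr do rewrite big_map.
  rewrite /X QDl !QDr !QSl QSr.
  under [X in _ = (_ + (_ + X)) * _ + _]eq_bigr do rewrite QZl QSr mulr_sumr.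
  under [X in _ = (_ + X + _) * _ + _]eq_bigr do rewrite QZr.
  rewrite big_cons big_cons/=.
  under [X in _ + X = _]eq_bigr do rewrite big_cons/=.
  rewrite big_split/= !mulrDl !mulr_suml -!addrA; congr (_ + _).
  rewrite [in LHS]addrCA [in RHS]addrCA.
  congr (_ + _); first by apply: eq_bigr => p _; rewrite QZl ay mulrA [Q _ _ * _]mulrC.
  congr (_ + _); first by apply: eq_bigr => p _; rewrite ay' mulrA [Q _ _ * _]mulrC.
  rewrite -big_split/=; apply: eq_bigr => p _.
  rewrite mulr_suml -big_split/=; apply: eq_bigr => q _.
  rewrite QZr ayy mulrDr; congr (_ + _).
  by move: (Q _ _) (a p) (a q)^* (hdot y y) => t1 t2 t3 t4; ring.
rewrite addr_ge0 ?mulr_ge0//; last by apply: IH; rewrite size_map.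
Qed.

End Schur.

(* By linear_boundedP, bopP says that |T x| <= M |x| for some M and all x. *)
Record boundedOp (R : realType) (H1 H2 : hilbertType R) := BoundedOp {
  bop_fun :> {linear H1 -> H2};
  bopP : bounded_near bop_fun (nbhs (0 : H1)) }.

Section boundedOp_theory.
Variables (R : realType) (H1 H2 : hilbertType R).
Implicit Type T : boundedOp H1 H2.

Lemma boundedOp_bound T : exists2 M, 0 <= M & forall x, nrm (T x) <= M * nrm x.
Proof.
have /linear_boundedP/pinfty_ex_gt0[M M0 TM] := bopP T.
have ME : M = (Re M)%:C by rewrite RRe_real// gtr0_real.
exists (Re M); first by rewrite -lecR -ME ltW.
by move=> x; rewrite -lecR RcM -ME -!nrmE.
Qed.

Lemma boundedOp_mk (f : H1 -> H2) (M : R) : linear f ->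
  (forall x, nrm (f x) <= M * nrm x) -> exists T, (T : H1 -> H2) = f.
Proof.
move=> lf fM.
pose F : {linear H1 -> H2} := HB.pack f (GRing.isLinear.Build _ _ _ _ _ lf).
have bF : bounded_near F (nbhs (0 : H1)).
  apply/linear_boundedP; exists M%:C; split; first by rewrite complex_real.
  move=> r Mr x; apply: le_trans (ler_wpM2r (normr_ge0 _) (ltW Mr)).
  by rewrite !nrmE -RcM lecR.
by exists (BoundedOp bF).
Qed.

End boundedOp_theory.

Section adjoint.
Variables (R : realType) (H1 H2 : hilbertType R).
Implicit Type T : boundedOp H1 H2.

Lemma adjoint_exists T : exists S : boundedOp H2 H1,
  forall x y, hdot (T x) y = hdot x (S y).
Proof.
have [M M0 TM] := boundedOp_bound T.
have /choice[S SP] y : exists w, forall x, hdot (T x) y = hdot x w.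
  apply: (@riesz _ _ _ +%R *:%R id (fun x => hdot (T x) y) (M * nrm y)) => //.
  - by move=> u v; rewrite linearD hdotDl.
  - by move=> a v; rewrite linearZ hdotZl.
  - move=> x; apply: le_trans (hdot_CS _ _) _.
    by rewrite !nrmE -!RcM lecR mulrAC ler_wpM2r ?nrm_ge0.
  - exact: 0.
have lS : linear S.
  move=> a x y; apply: hdot_inj => z.
  by rewrite -SP !hdotDr !hdotZr !SP.
have SM y : nrm (S y) <= M * nrm y.
  have [->|Sy0] := eqVneq (S y) 0.
    by rewrite {1}/nrm normr0 mulr_ge0 ?nrm_ge0.
  have nSy : 0 < nrm (S y) by rewrite -ltcR -nrmE normr_gt0.
  rewrite -(ler_pM2r nSy) -expr2 -ipxx /ip -SP.
  apply: le_trans (ler_norm _) _; apply: le_trans (ip_CS _ _) _.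
  by rewrite mulrAC ler_wpM2r ?nrm_ge0.
by have [T' T'E] := boundedOp_mk lS SM; exists T' => x y; rewrite T'E.
Qed.

Definition adjoint T : boundedOp H2 H1 := sval (cid (adjoint_exists T)).

Lemma adjointE T x y : hdot (T x) y = hdot x (adjoint T y).
Proof. exact: (svalP (cid (adjoint_exists T))). Qed.

Lemma adjointEl T x y : hdot (adjoint T y) x = hdot y (T x).
Proof. by rewrite hdotC -adjointE -hdotC. Qed.

Lemma adjoint_unique T (S : H2 -> H1) :
  (forall x y, hdot (T x) y = hdot x (S y)) -> S = adjoint T.
Proof.
by move=> TS; apply/funext => y; apply: hdot_inj => x; rewrite -TS adjointE.
Qed.

End adjoint.

(* A realization of the Hilbert space tensor product of H1 and H2. The three
   properties of tens determine the space up to a unique unitary isomorphism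
   compatible with the elementary tensors. The set in dense_tens is the
   algebraic tensor product: by bilinearity it is closed under scaling. *)
Record hilbertTensor (R : realType) (H1 H2 : hilbertType R) := HilbertTensor {
  tensor_space :> hilbertType R;
  tens : {bilinear H1 -> H2 -> tensor_space};
  hdot_tens : forall x x' y y',
    hdot (tens x y) (tens x' y') = hdot x x' * hdot y y';
  dense_tens : dense [set z | exists s : seq (H1 * H2),
    z = \sum_(p <- s) tens p.1 p.2] }.

Section tensor_bound.
Variables (R : realType) (H1 H2 : hilbertType R) (K : hilbertTensor H1 H2).
Implicit Type s : seq (H1 * H2).

Definition elt s : K := \sum_(p <- s) tens K p.1 p.2.

Lemma hdot_elt s t :
  hdot (elt s) (elt t) = \sum_(p <- s) \sum_(q <- t) hdot p.1 q.1 * hdot p.2 q.2.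
Proof.
rewrite /elt hdot_suml; apply: eq_bigr => p _.
by rewrite hdot_sumr; apply: eq_bigr => q _; exact: hdot_tens.
Qed.

Lemma elt_cat s t : elt (s ++ t) = elt s + elt t.
Proof. exact: big_cat. Qed.

Lemma elt_scale a s : elt (map (fun p => (a *: p.1, p.2)) s) = a *: elt s.
Proof.
rewrite /elt big_map scaler_sumr; apply: eq_bigr => p _ /=.
exact: linearZl_LR.
Qed.

Lemma elt_near (w : K) (e : R) : 0 < e -> exists s, nrm (w - elt s) < e.
Proof.
move=> e0; have e0' : 0 < e%:C by rewrite ltcR.
have [|z [wz [s zE]]] := @dense_tens _ _ _ K (ball w e%:C) _ (ball_open w e%:C).
  by exists w; exact: ballxx.
exists s; move: wz; rewrite -ball_normE/= zE => wz.
by rewrite -ltcR -nrmE.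
Qed.

Lemma elt_norm_le (w : K) (M : R) : 0 <= M ->
  (forall s, `|hdot (elt s) w| <= (M * nrm (elt s))%:C) -> nrm w <= M.
Proof.
move=> M0 Mw; have [->|w0] := eqVneq w 0; first by rewrite /nrm normr0.
have nw : 0 < nrm w by rewrite -ltcR -nrmE normr_gt0.
rewrite -(ler_pM2r nw); apply/ler_addgt0Pr => e e0.
pose d := e / (M + nrm w); have Mn : 0 < M + nrm w by rewrite ltr_wpDl.
have d0 : 0 < d by rewrite divr_gt0.
have [s sw] := elt_near w d0.
have h1 : ip (elt s) w <= M * nrm (elt s).
  rewrite -lecR; apply: le_trans (Mw s); apply: le_trans (normc_ge_Re _).
  by rewrite lecR ler_norm.
have h2 : ip (w - elt s) w <= nrm (w - elt s) * nrm w.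
  exact: le_trans (ler_norm _) (ip_CS _ _).
have h3 : nrm (elt s) <= nrm w + nrm (w - elt s).
  rewrite -lecR rmorphD /= -!nrmE.
  by rewrite -{1}(subKr w (elt s)) ler_normB.
have h4 : nrm w * nrm w = ip (elt s) w + ip (w - elt s) w.
  by rewrite -expr2 -ipxx ipDl ipNl addrC subrK.
rewrite h4; apply: le_trans (lerD h1 h2) _.
have -> : M * nrm w + e = M * (nrm w + d) + d * nrm w.
  have dE : d * (M + nrm w) = e by rewrite divfK ?gt_eqF.
  by rewrite -dE; ring.
apply: lerD; last by rewrite ler_wpM2r ?nrm_ge0// ltW.
rewrite ler_wpM2l//; apply: le_trans h3 _; rewrite lerD2l; exact: ltW.
Qed.

Lemma tens_inj (w w' : K) :
  (forall x y, hdot (tens K x y) w = hdot (tens K x y) w') -> w = w'.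
Proof.
move=> ww'; apply/eqP; rewrite -subr_eq0.
suff : nrm (w - w') <= 0 by rewrite -lecR -nrmE normr_le0.
apply: elt_norm_le => // s.
rewrite mul0r normr_le0 /elt hdot_suml big1// => p _.
by rewrite hdotDr hdotNr ww' subrr.
Qed.

Section one_sided.
Variables (A : H1 -> H1) (M : R).
Hypothesis lA : linear A.
Hypothesis AM : forall x, nrm (A x) <= M * nrm x.

Lemma elt_mapl_le s : 
  nrm (elt (map (fun p => (A p.1, p.2)) s)) <= `|M| * nrm (elt s).
Proof.
pose Q x x' := (M ^+ 2)%:C * hdot x x' - hdot (A x) (A x').
have AD x y : A (x + y) = A x + A y by rewrite -[x]scale1r lA !scale1r.
have A0 : A 0 = 0 by apply: (addrI (A 0)); rewrite -AD !addr0.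
have AZ a x : A (a *: x) = a *: A x by rewrite -[a *: x]addr0 lA A0 addr0.
have : 0 <= \sum_(p <- s) \sum_(q <- s) Q p.1 q.1 * hdot p.2 q.2.
  apply: psd_schur.
  - by move=> x y z; rewrite /Q AD !hdotDl; ring.
  - by move=> x y z; rewrite /Q AD !hdotDr; ring.
  - by move=> a x y; rewrite /Q AZ !hdotZl; ring.
  - by move=> a x y; rewrite /Q AZ !hdotZr; ring.
  - move=> x; rewrite /Q subr_ge0 !hdotxx -RcM lecR -exprMn.
    rewrite -(real_normK (num_real (M * _))).
    rewrite ler_pXn2r ?nnegrE ?nrm_ge0//.
    by apply: le_trans (AM x) (ler_norm _).
have -> : \sum_(p <- s) \sum_(q <- s) Q p.1 q.1 * hdot p.2 q.2 =
   (M ^+ 2)%:C * hdot (elt s) (elt s) -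
   hdot (elt (map (fun p => (A p.1, p.2)) s)) (elt (map (fun p => (A p.1, p.2)) s)).
  rewrite !hdot_elt big_map mulr_sumr -sumrB; apply: eq_bigr => p _.
  rewrite big_map mulr_sumr -sumrB; apply: eq_bigr => q _.
  by rewrite /Q mulrBl mulrA.
rewrite subr_ge0 !hdotxx -RcM lecR -[M ^+ 2]real_normK ?num_real// -exprMn.
by rewrite ler_pXn2r ?nnegrE ?mulr_ge0 ?nrm_ge0.
Qed.

End one_sided.

Lemma elt_mapr_le (A : H2 -> H2) (M : R) s : linear A ->
  (forall x, nrm (A x) <= M * nrm x) ->
  nrm (elt (map (fun p => (p.1, A p.2)) s)) <= `|M| * nrm (elt s).
Proof.
move=> lA AM.
pose Q x x' := (M ^+ 2)%:C * hdot x x' - hdot (A x) (A x').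
have AD x y : A (x + y) = A x + A y by rewrite -[x]scale1r lA !scale1r.
have A0 : A 0 = 0 by apply: (addrI (A 0)); rewrite -AD !addr0.
have AZ a x : A (a *: x) = a *: A x by rewrite -[a *: x]addr0 lA A0 addr0.
have : 0 <= \sum_(p <- [seq (p.2, p.1) | p <- s]) \sum_(q <- [seq (p.2, p.1) | p <- s])
    Q p.1 q.1 * hdot p.2 q.2.
  apply: psd_schur.
  - by move=> x y z; rewrite /Q AD !hdotDl; ring.
  - by move=> x y z; rewrite /Q AD !hdotDr; ring.
  - by move=> a x y; rewrite /Q AZ !hdotZl; ring.
  - by move=> a x y; rewrite /Q AZ !hdotZr; ring.
  - move=> x; rewrite /Q subr_ge0 !hdotxx -RcM lecR -exprMn.
    rewrite -(real_normK (num_real (M * _))).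
    rewrite ler_pXn2r ?nnegrE ?nrm_ge0//.
    by apply: le_trans (AM x) (ler_norm _).
have -> : \sum_(p <- [seq (p.2, p.1) | p <- s]) \sum_(q <- [seq (p.2, p.1) | p <- s])
    Q p.1 q.1 * hdot p.2 q.2 =
   (M ^+ 2)%:C * hdot (elt s) (elt s) -
   hdot (elt (map (fun p => (p.1, A p.2)) s)) (elt (map (fun p => (p.1, A p.2)) s)).
  rewrite !hdot_elt !big_map mulr_sumr -sumrB; apply: eq_bigr => p _.
  rewrite !big_map mulr_sumr -sumrB; apply: eq_bigr => q _ /=.
  by rewrite /Q; ring.
rewrite subr_ge0 !hdotxx -RcM lecR -[M ^+ 2]real_normK ?num_real// -exprMn.
by rewrite ler_pXn2r ?nnegrE ?mulr_ge0 ?nrm_ge0.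
Qed.

End tensor_bound.

Section tensor_op.
Variables (R : realType) (H1 H2 : hilbertType R) (K : hilbertTensor H1 H2).
Variables (T : boundedOp H1 H1) (S : boundedOp H2 H2).

Lemma tensor_op_exists : exists U : boundedOp K K,
  forall x y, U (tens K x y) = tens K (T x) (S y).
Proof.
have [M M0 TM] := boundedOp_bound (adjoint T).
have [N N0 SN] := boundedOp_bound (adjoint S).
pose ad (s : seq (H1 * H2)) := map (fun p => (adjoint T p.1, adjoint S p.2)) s.
have ad_le s : nrm (elt K (ad s)) <= (M * N) * nrm (elt K s).
  have -> : ad s = map (fun p => (adjoint T p.1, p.2))
      (map (fun p => (p.1, adjoint S p.2)) s) by rewrite -map_comp.
  apply: le_trans (elt_mapl_le _ _ TM _) _; first exact: linearP.
  rewrite ger0_norm// -mulrA ler_wpM2l//.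
  apply: le_trans (elt_mapr_le _ _ _ SN) _; first exact: linearP.
  by rewrite ger0_norm.
have /choice[U UP] (z : K) : exists w, forall s,
    hdot (elt K (ad s)) z = hdot (elt K s) w.
  apply: (@riesz _ _ _ cat (fun a => map (fun p => (a *: p.1, p.2))) (elt K)
    (fun s => hdot (elt K (ad s)) z) (M * N * nrm z)).
  - exact: elt_cat.
  - exact: elt_scale.
  - by move=> u v; rewrite /ad map_cat elt_cat hdotDl.
  - move=> a s; rewrite -hdotZl -elt_scale /ad -!map_comp.
    by congr (hdot (elt K _) z); apply: eq_map => p /=; rewrite linearZ.
  - move=> s; apply: le_trans (hdot_CS _ _) _.
    by rewrite !nrmE -!RcM lecR mulrAC ler_wpM2r ?nrm_ge0.
  - exact: [::].
have UE x y z : hdot (tens K x y) (U z) =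
    hdot (tens K (adjoint T x) (adjoint S y)) z.
  by have := UP z [:: (x, y)]; rewrite /elt/= !big_seq1.
have lU : linear U.
  move=> a u v; apply: (tens_inj (K := K)) => x y.
  by rewrite UE !hdotDr !hdotZr !UE.
have UM z : nrm (U z) <= (M * N) * nrm z.
  apply: elt_norm_le => [|s]; first by rewrite !mulr_ge0 ?nrm_ge0.
  rewrite -UP; apply: le_trans (hdot_CS _ _) _.
  by rewrite !nrmE -RcM lecR mulrAC ler_wpM2r ?nrm_ge0.
have [V VE] := boundedOp_mk lU UM; exists V => x y; rewrite VE.
apply: (tens_inj (K := K)) => x' y'.
by rewrite UE !hdot_tens !adjointEl.
Qed.

Definition tensor_op : boundedOp K K := sval (cid tensor_op_exists).

Lemma tensor_opE x y : tensor_op (tens K x y) = tens K (T x) (S y).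
Proof. exact: (svalP (cid tensor_op_exists)). Qed.

Lemma tensor_op_unique (U : boundedOp K K) :
  (forall x y, U (tens K x y) = tens K (T x) (S y)) ->
  (U : K -> K) = tensor_op.
Proof.
move=> UE; apply/funext => z; apply: hdot_inj => w.
rewrite -!adjointEl; congr (hdot _ z).
apply: (tens_inj (K := K)) => x y.
by rewrite -!adjointE UE tensor_opE.
Qed.

End tensor_op.


(* The powers T^n and (T^* )^k are iterates of functions. *)
Definition quasi_power_posinormal (R : realType) (H : hilbertType R) (k n : nat)
    (T : boundedOp H H) : Prop :=
  range (iter k (adjoint T) \o iter n T) `<=` range (iter k.+1 (adjoint T)).

(* Main.v *)
(* Put A_X = X^*k X^n and B_X = X^*(k+1) for X = T, S. By Douglas' lemma, the
   inclusion of ranges amounts to |A_X^* y| <= c |B_X^* y| for all y. These bounds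
   multiply on the algebraic tensor product: by Schur's product theorem, an
   inequality between positive semidefinite forms survives being multiplied by a
   Gram matrix, and A_T^* (x) A_S^* is compared with B_T^* (x) A_S^* and then with
   B_T^* (x) B_S^*. Finally, the bound makes B^* u |-> <A^* u, z> a bounded
   functional, and a vector w representing it by Riesz satisfies B w = A z. *)
From HB Require Import structures.
Require Import Defs.
From mathcomp Require Import all_boot all_order all_algebra all_classical all_reals.
From mathcomp Require Import topology normedtype complex.
From mathcomp Require Import sequences interval_inference ring lra.
Set Implicit Arguments. Unset Strict Implicit. Unset Printing Implicit Defensive.
Import Order.TTheory GRing.Theory Num.Theory.
Import numFieldNormedType.Exports.
Local Open Scope classical_set_scope.
Local Open Scope ring_scope.

Local Notation "r %:C" := (real_complex _ r) (format "r %:C") : ring_scope.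

(** * Completeness, uniform boundedness and Douglas' lemma *)

Section norm.
Variables (R : realType) (H : hilbertType R).
Implicit Types x y : H.

Lemma nrm_triangle x y : nrm (x + y) <= nrm x + nrm y.
Proof. by rewrite -lecR rmorphD/= -!nrmE ler_normD. Qed.

Lemma nrmZ (r : R) x : nrm (r%:C *: x) = `|r| * nrm x.
Proof.
apply/eqP; rewrite -(@eqrXn2 _ 2) ?mulr_ge0 ?nrm_ge0//; apply/eqP.
by rewrite -ipxx ipZl ipZr ipxx exprMn real_normK ?num_real// mulrA.
Qed.

Lemma nrm0 : nrm (0 : H) = 0.
Proof. by rewrite /nrm normr0. Qed.

Lemma nrm_eq0 x : nrm x = 0 -> x = 0.
Proof. by move=> x0; apply/eqP; rewrite -normr_eq0 nrmE x0. Qed.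

(** Completeness gives the limit. The bound is the sum of [3^-i] over [i > n]: half of [3^-n], so a
    hump of size [3^-n] outlives all later steps. *)
Lemma geometric_steps_cvg (u : nat -> H) :
  (forall n, nrm (u n.+1 - u n) <= 3^-1 ^+ n.+1) ->
  exists l, forall n, nrm (l - u n) <= 3^-1 ^+ n / 2.
Proof.
move=> du.
(* The bound is the exact partial sum of the geometric series, which makes the induction close. *)
have dist k n : nrm (u (n + k)%N - u n) <= (3^-1 ^+ n - 3^-1 ^+ (n + k)) / 2.
  elim: k => [|k IH]; first by rewrite addn0 !subrr nrm0 mul0r.
  rewrite addnS -(subrKA (u (n + k)%N)).
  apply: le_trans (nrm_triangle _ _) _; apply: le_trans (lerD (du _) IH) _.
  by rewrite exprS; set a := _ ^+ n; set b := _ ^+ (n + k); lra.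
have {}dist k n : (n <= k)%N -> nrm (u k - u n) <= 3^-1 ^+ n / 2.
  move=> nk; rewrite -(subnKC nk); apply: le_trans (dist _ _) _.
  have : 0 <= 3^-1 ^+ (n + (k - n)) :> R by rewrite exprn_ge0.
  by set a := _ ^+ n; set b := _ ^+ _; lra.
have small (e : R) : 0 < e -> \forall n \near \oo, (3^-1 : R) ^+ n / 2 < e.
  move=> e0.
  have : (3^-1 : R) ^+ n @[n --> \oo] --> (0 : R).
    by apply: cvg_expr; rewrite ger0_norm; lra.
  move=> /cvgrPdist_lt/(_ e e0); apply: filterS => n.
  rewrite sub0r normrN ger0_norm ?exprn_ge0//.
  have : 0 <= (3^-1 : R) ^+ n by rewrite exprn_ge0.
  by set a := _ ^+ n; lra.
have cu : cauchy (u @ \oo).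
  apply: cauchy_exP => e e0.
  have eR : e = (complex.Re e)%:C by rewrite RRe_real// gtr0_real.
  have e'0 : 0 < complex.Re e by rewrite -ltcR -eR.
  have [n _ /(_ n (leqnn n))/= ne] := small _ e'0.
  exists (u n), n => // k /= nk; rewrite -ball_normE/= distrC nrmE eR ltcR.
  exact: le_lt_trans (dist _ _ nk) ne.
have /cvg_ex[l ul] : cvg (u @ \oo) by exact: cauchy_cvg.
exists l => n; apply/ler_addgt0Pr => e e0.
have : \forall k \near \oo, `|l - u k| < e%:C.
  by apply: cvgr_dist_lt => //; rewrite ltcR.
have : \forall k \near \oo, (n <= k)%N by exists n.
move=> nk near_l; near \oo => k.
have lk : nrm (l - u k) < e by rewrite -ltcR -nrmE; near: k.
have kn : nrm (u k - u n) <= 3^-1 ^+ n / 2 by apply: dist; near: k.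
rewrite -(subrKA (u k)); apply: le_trans (nrm_triangle _ _) _.
by rewrite addrC lerD// ltW.
Unshelve. all: by end_near. Qed.

(* Uniform boundedness by Sokal's gliding hump: the step of length 3^-(n+1) in
   the direction +-a_n makes |<x, a_n>| at least 3^-(n+1) |a_n|, and the later
   steps, of total length 3^-(n+1) / 2, keep half of it. *)
Lemma weakly_bounded (V : Type) (a : V -> H) :
  (forall x, exists M, forall v, `|ip x (a v)| <= M) ->
  exists M, forall v, nrm (a v) <= M.
Proof.
move=> wb; apply: contrapT => /forallNP unb.
(* The power of 3 cancels the step length and the factor 2 pays for the half lost to later steps,
   leaving at least [n.+1] against any bound [M]. *)
have /choice[v vP] n : exists v, 2 * 3 ^+ n.+1 * n.+1%:R < nrm (a v).
  have /existsNP[v /negP] := unb (2 * 3 ^+ n.+1 * n.+1%:R).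
  by rewrite -ltNge => nv; exists v.
pose b n := a (v n).
have b0 n : 0 < nrm (b n).
  by apply: le_lt_trans (vP n); rewrite !mulr_ge0// exprn_ge0.
(* The sign follows that of [ip x (b n)], so the step cannot cancel it. *)
pose step n x := x +
  ((if 0 <= ip x (b n) then 1 else -1) * (3^-1 ^+ n.+1 / nrm (b n)))%:C *: b n.
pose u := fix u n := if n is m.+1 then step m (u m) else 0.
have [|l lu] := geometric_steps_cvg (u := u).
  move=> n /=; rewrite /step addrC addKr nrmZ normrM.
  rewrite (_ : `|if _ then _ else _| = 1); last first.
    by case: ifP; rewrite ?normrN normr1.
  by rewrite mul1r ger0_norm ?divr_ge0 ?nrm_ge0 ?exprn_ge0// divfK ?gt_eqF.
have hump n : 3^-1 ^+ n.+1 * nrm (b n) <= `|ip (u n.+1) (b n)|.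
  rewrite /= /step ipDl ipZl ipxx.
  have -> c : c * (3^-1 ^+ n.+1 / nrm (b n)) * nrm (b n) ^+ 2 =
      c * (3^-1 ^+ n.+1 * nrm (b n)).
    by rewrite expr2 -!mulrA mulKf ?gt_eqF.
  have : 0 <= 3^-1 ^+ n.+1 * nrm (b n) by rewrite mulr_ge0 ?exprn_ge0 ?nrm_ge0.
  set d := _ * nrm _; set t := ip _ _ => d0.
  case: (leP 0 t) => t0; first by rewrite mul1r ger0_norm; lra.
  by rewrite mulN1r ltr0_norm; lra.
have [M lM] := wb l.
have [n Mn] : exists n : nat, M < n.+1%:R.
  by exists (Num.truncn M); exact: truncnS_gt.
suff : n.+1%:R <= `|ip l (b n)|.
  by move=> /le_trans/(_ (lM _)); rewrite leNgt Mn.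
have tail : `|ip (l - u n.+1) (b n)| <= 3^-1 ^+ n.+1 / 2 * nrm (b n).
  by apply: le_trans (ip_CS _ _) _; rewrite ler_wpM2r ?nrm_ge0.
have ubn : 2 * n.+1%:R <= 3^-1 ^+ n.+1 * nrm (b n).
  by rewrite exprVn ler_pdivlMl ?exprn_gt0// mulrCA mulrA ltW ?vP.
have -> : ip l (b n) = ip (u n.+1) (b n) + ip (l - u n.+1) (b n).
  by rewrite -ipDl addrC subrK.
have := lerB_normD (ip (u n.+1) (b n)) (ip (l - u n.+1) (b n)).
move: (hump n) tail ubn.
set p := `|ip (u _) _|; set q := `|ip (l - _) _|; set r := `|_ + _|.
rewrite mulrAC; set t := _ * nrm _; lra.
Qed.

End norm.

(* The range inclusion bounds <x, As y> / |Bs y| for each fixed x, so this is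
   Douglas' lemma by uniform boundedness. *)
Lemma range_sub_majorized (R : realType) (H1 H2 H : hilbertType R)
    (A : H1 -> H) (B : H2 -> H) (As : H -> H1) (Bs : H -> H2) :
  (forall x y, hdot (A x) y = hdot x (As y)) ->
  (forall x y, hdot (B x) y = hdot x (Bs y)) ->
  range A `<=` range B ->
  exists c, forall y, nrm (As y) <= c * nrm (Bs y).
Proof.
move=> AE BE AB.
have AB' x : exists x', forall y, hdot x (As y) = hdot x' (Bs y).
  have [x' _ x'x] : range B (A x) by apply: AB; exists x.
  by exists x' => y; rewrite -AE -x'x BE.
(* Where [Bs y = 0] the inverse is 0 and the family carries no information; there [AB'] gives
   [As y = 0] directly. *)
have [|c cP] := @weakly_bounded R H1 H (fun y => (nrm (Bs y))^-1%:C *: As y).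
  move=> x; have [x' xx'] := AB' x; exists (nrm x') => y.
  rewrite ipZr /ip xx' -/(ip _ _) normrM ger0_norm ?invr_ge0 ?nrm_ge0//.
  have [y0|y0] := eqVneq (nrm (Bs y)) 0; first by rewrite y0 invr0 mul0r nrm_ge0.
  by rewrite ler_pdivrMl ?lt_neqAle 1?eq_sym ?y0 ?nrm_ge0// mulrC ip_CS.
exists c => y; have [y0|y0] := eqVneq (nrm (Bs y)) 0.
  suff -> : As y = 0 by rewrite nrm0 y0 mulr0.
  apply: hdot_inj => z; have [z' ->] := AB' z.
  by rewrite (nrm_eq0 y0) !hdot0r.
have := cP y; rewrite nrmZ ger0_norm ?invr_ge0 ?nrm_ge0//.
by rewrite ler_pdivrMl ?lt_neqAle 1?eq_sym ?y0 ?nrm_ge0// mulrC.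
Qed.

(** * Norm bounds on algebraic tensors *)

Section majorization.
Variables (R : realType).

(** The norm bound makes the form [Q] below positive semidefinite; the second components enter only
    through their Gram matrix. *)
Lemma schur_majorized (H1 H2 : hilbertType R) (A B : H1 -> H1) (c : R)
    (s : seq (H1 * H2)) : linear A -> linear B ->
  (forall x, nrm (A x) <= c * nrm (B x)) ->
  \sum_(p <- s) \sum_(q <- s) hdot (A p.1) (A q.1) * hdot p.2 q.2 <=
  (c ^+ 2)%:C * \sum_(p <- s) \sum_(q <- s) hdot (B p.1) (B q.1) * hdot p.2 q.2.
Proof.
move=> lA lB AB.
pose A' : {linear H1 -> H1} := HB.pack A (GRing.isLinear.Build _ _ _ _ _ lA).
pose B' : {linear H1 -> H1} := HB.pack B (GRing.isLinear.Build _ _ _ _ _ lB).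
pose Q x x' := (c ^+ 2)%:C * hdot (B' x) (B' x') - hdot (A' x) (A' x').
have : 0 <= \sum_(p <- s) \sum_(q <- s) Q p.1 q.1 * hdot p.2 q.2.
  apply: psd_schur.
  - by move=> x y z; rewrite /Q (linearD A') (linearD B') !hdotDl; ring.
  - by move=> x y z; rewrite /Q (linearD A') (linearD B') !hdotDr; ring.
  - by move=> a x y; rewrite /Q (linearZ_LR A') (linearZ_LR B') !hdotZl; ring.
  - by move=> a x y; rewrite /Q (linearZ_LR A') (linearZ_LR B') !hdotZr; ring.
  - move=> x; rewrite /Q subr_ge0 !hdotxx -RcM lecR -exprMn.
    by rewrite lerXn2r ?nnegrE ?nrm_ge0//; apply: le_trans (AB x); exact: nrm_ge0.
move=> Q_ge0; rewrite -subr_ge0; move: Q_ge0; rewrite mulr_sumr -sumrB.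
congr (0 <= _); apply: eq_bigr => p _.
by rewrite mulr_sumr -sumrB; apply: eq_bigr => q _; rewrite /Q mulrBl mulrA.
Qed.

Variables (H1 H2 : hilbertType R) (K : hilbertTensor H1 H2).
Implicit Type s : seq (H1 * H2).

Lemma nrm_le_of_hdot (x y : K) (c : R) : 0 <= c ->
  hdot x x <= (c ^+ 2)%:C * hdot y y -> nrm x <= c * nrm y.
Proof.
move=> c0; rewrite !hdotxx -RcM lecR -exprMn.
by rewrite ler_pXn2r ?nnegrE ?mulr_ge0 ?nrm_ge0.
Qed.

(** Acting on representing sequences rather than on vectors of [K], it raises no question of
    independence of the representative. *)
Definition elt_map (A : H1 -> H1) (B : H2 -> H2) s : K :=
  elt K [seq (A p.1, B p.2) | p <- s].

Lemma hdot_elt_map A B s : hdot (elt_map A B s) (elt_map A B s) =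
  \sum_(p <- s) \sum_(q <- s) hdot (A p.1) (A q.1) * hdot (B p.2) (B q.2).
Proof.
by rewrite hdot_elt big_map; apply: eq_bigr => p _; rewrite big_map.
Qed.

Lemma elt_map_majorized (A B : H1 -> H1) (C D : H2 -> H2) (c d : R) s :
  linear A -> linear B -> linear C -> linear D -> 0 <= c -> 0 <= d ->
  (forall x, nrm (A x) <= c * nrm (B x)) ->
  (forall x, nrm (C x) <= d * nrm (D x)) ->
  nrm (elt_map A C s) <= c * d * nrm (elt_map B D s).
Proof.
move=> lA lB lC lD c0 d0 AB CD.
have h1 : nrm (elt_map A C s) <= c * nrm (elt_map B C s).
  apply: nrm_le_of_hdot => //; rewrite !hdot_elt_map.
  have := schur_majorized [seq (p.1, C p.2) | p <- s] lA lB AB.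
  rewrite !big_map; under eq_bigr do rewrite big_map.
  by under [X in _ <= _ * X -> _]eq_bigr do rewrite big_map.
apply: le_trans h1 _; rewrite -mulrA ler_wpM2l//.
apply: nrm_le_of_hdot => //; rewrite !hdot_elt_map.
(* The components are swapped so that [C] is now compared with [D], against the Gram matrix of the
   [B p.1]. *)
have := schur_majorized [seq (p.2, B p.1) | p <- s] lC lD CD.
rewrite !big_map; under eq_bigr do rewrite big_map.
under [X in _ <= _ * X -> _]eq_bigr do rewrite big_map.
congr (_ <= _ * _); apply: eq_bigr => p _; apply: eq_bigr => q _ /=;
  exact: mulrC.
Qed.

End majorization.

(** * Iterates, their adjoints and posinormality *)

Lemma linear_iter (R : realType) (H : hilbertType R) (T : boundedOp H H) n :
  linear (iter n T).
Proof. by elim: n => [|n IH] a x y //=; rewrite IH linearP. Qed.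

Lemma hdot_iter (R : realType) (H : hilbertType R) (T : boundedOp H H) n x y :
  hdot (iter n T x) y = hdot x (iter n (adjoint T) y).
Proof. by elim: n x y => //= n IH x y; rewrite adjointE IH -iterSr. Qed.

Lemma hdot_iterV (R : realType) (H : hilbertType R) (T : boundedOp H H) n x y :
  hdot (iter n (adjoint T) x) y = hdot x (iter n T y).
Proof. by rewrite hdotC -hdot_iter -hdotC. Qed.

(** Douglas' lemma for [T^*k T^n] and [T^*(k+1)], whose adjoints are [T^*n T^k] and [T^(k+1)]. *)
Lemma posinormal_majorized (R : realType) (H : hilbertType R) (k n : nat)
    (T : boundedOp H H) : quasi_power_posinormal k n T ->
  exists2 c, 0 <= c & forall x,
    nrm (iter n (adjoint T) (iter k T x)) <= c * nrm (iter k.+1 T x).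
Proof.
move=> Tkn.
have [||c cP] := @range_sub_majorized R H H H
    (iter k (adjoint T) \o iter n T) (iter k.+1 (adjoint T))
    (iter n (adjoint T) \o iter k T) (iter k.+1 T) _ _ Tkn.
- by move=> x y /=; rewrite hdot_iterV hdot_iter.
- by move=> x y; rewrite hdot_iterV.
exists `|c| => // x; apply: le_trans (cP x) _.
by rewrite ler_wpM2r ?nrm_ge0 ?ler_norm.
Qed.

(** * Adjoint and powers of the tensor product operator *)

Section tensor_adjoint.
Variables (R : realType) (H1 H2 : hilbertType R) (K : hilbertTensor H1 H2).
Variables (T : boundedOp H1 H1) (S : boundedOp H2 H2).

Lemma adjoint_tensor_op x y :
  adjoint (tensor_op K T S) (tens K x y) = tens K (adjoint T x) (adjoint S y).
Proof.
apply: (tens_inj (K := K)) => x' y'.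
by rewrite -adjointE tensor_opE !hdot_tens !adjointE.
Qed.

Lemma iter_tensor_op n x y :
  iter n (tensor_op K T S) (tens K x y) = tens K (iter n T x) (iter n S y).
Proof. by elim: n => //= n ->; rewrite tensor_opE. Qed.

Lemma iter_adjoint_tensor_op n x y :
  iter n (adjoint (tensor_op K T S)) (tens K x y) =
  tens K (iter n (adjoint T) x) (iter n (adjoint S) y).
Proof. by elim: n => //= n ->; rewrite adjoint_tensor_op. Qed.

End tensor_adjoint.

Theorem theorem2p15 (R : realType) (H : hilbertType R) (HH : hilbertTensor H H)
    (k n : nat) (k_gt0 : (0 < k)%N) (n_gt0 : (0 < n)%N)
    (T S : boundedOp H H)
    (T_neq0 : (T : H -> H) <> (fun=> 0)) (S_neq0 : (S : H -> H) <> (fun=> 0))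
    (Tkn : quasi_power_posinormal k n T) (Skn : quasi_power_posinormal k n S) :
  quasi_power_posinormal k n (tensor_op HH T S).
Proof.
have [c c0 Tc] := posinormal_majorized Tkn.
have [d d0 Sd] := posinormal_majorized Skn.
(* This is the adjoint of [X^*k X^n]. *)
pose A (X : boundedOp H H) := iter n (adjoint X) \o iter k X.
have lA X : linear (A X) by move=> a x y; rewrite /A /= !linear_iter.
move=> _ [z _ <-] /=.
pose At := @elt_map R H H HH (A T) (A S).
pose Bt := @elt_map R H H HH (iter k.+1 T) (iter k.+1 S).
(* With sequences as parameters, the functional need not be shown to depend on [Bt s] alone. *)
have [||||s|w wP] := @riesz R HH _ cat (fun a => map (fun p => (a *: p.1, p.2)))
  Bt (fun s => hdot (At s) z) (c * d * nrm z) _ _ _ _ _ [::].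
- by move=> u v; rewrite /Bt /elt_map map_cat elt_cat.
- move=> a s; rewrite /Bt /elt_map -elt_scale -!map_comp.
  congr (elt HH _); apply: eq_map => p /=.
  by rewrite -iterS (scalable_linear (@linear_iter _ _ _ _)).
- by move=> u v; rewrite /At /elt_map map_cat elt_cat hdotDl.
- move=> a s; rewrite -hdotZl /At /elt_map -elt_scale -!map_comp.
  congr (hdot (elt HH _) z); apply: eq_map => p /=.
  by rewrite (scalable_linear (lA _)).
- apply: le_trans (hdot_CS _ _) _.
  rewrite !nrmE -!RcM lecR mulrAC ler_wpM2r ?nrm_ge0//.
  by apply: elt_map_majorized => //; exact: linear_iter.
(* By density it is enough to test against elementary tensors, which are the one-term sequences in
   [wP]. *)
exists w => //; apply: (tens_inj (K := HH)) => x y.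
have := wP [:: (x, y)]; rewrite /At /Bt /elt_map /elt !big_seq1 /= => e.
rewrite -adjointE tensor_opE -hdot_iter iter_tensor_op -!iterSr.
by rewrite -hdot_iter iter_tensor_op -[RHS]hdot_iterV iter_adjoint_tensor_op.
Qed.
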